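(* Let $\{f_k\}_{k=1}^\infty$ be a sequence of mean zero independent functions on $[0,1]$ equimeasurable with some function $f\in L^2=L^2[0,1]$. Then the unit ball $B_H=\{x\in H:\|x\|_{L^2}\le1\}$ of the closed linear span $H$ of $\{f_k\}$ in $L^2$ consists of functions having equicontinuous norms in $L^2$.
   Context: $m$ is Lebesgue measure on $[0,1]$. Measurable functions $x,y$ on $[0,1]$ are equimeasurable if $m\{|x|>\tau\}=m\{|y|>\tau\}$ for all $\tau>0$. Mean zero means $\int_0^1 f_k(t)\,dt=0$. The functions of a set $K\subset L^2$ have equicontinuous norms in $L^2$ if $\lim_{\delta\to0}\sup_{m(E)<\delta}\sup_{x\in K}\|x\chi_E\|_{L^2}=0$. *)

(* Defs.v *)
From HB Require Import structures.
From mathcomp Require Import all_boot all_order all_algebra finmap.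
From mathcomp Require Import all_classical all_reals all_analysis.

Set Implicit Arguments.
Unset Strict Implicit.
Unset Printing Implicit Defensive.

Import Order.TTheory GRing.Theory Num.Theory.
Import numFieldNormedType.Exports.

Local Open Scope classical_set_scope.
Local Open Scope ring_scope.

(* The real line with the sigma-algebra of Lebesgue (not just Borel)
   measurable sets, i.e. the domain of [completed_lebesgue_measure]. *)
Definition lebesgue_line (R : realType) : measurableType _ :=
  caratheodory_type (@wlength R idfun)^*%mu.

Lemma measurable_unit_interval (R : realType) :
  measurable (`[0%R, 1%R]%classic : set (lebesgue_line R)).
Proof. by apply: sub_caratheodory; exact: (@measurable_itv R `[0, 1]). Qed.

(* L^2[0,1] is modelled on the whole line with a measure carried by [0,1]:
   a measurable function on [0,1] is one on the line (extended by 0, say), and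
   its values outside [0,1] are irrelevant. *)
Definition lebesgue01 (R : realType) : set (lebesgue_line R) -> \bar R :=
  mrestr completed_lebesgue_measure (@measurable_unit_interval R).

Arguments lebesgue01 : clear implicits.

HB.instance Definition _ (R : realType) := Measure.on (lebesgue01 R).

Lemma lebesgue01_setT (R : realType) : lebesgue01 R [set: lebesgue_line R] = 1%E.
Proof.
rewrite /lebesgue01 /mrestr setTI.
have := @lebesgue_measure_itv R `[0, 1]; rewrite /= lte_fin ltr01 oppr0 adde0.
by [].
Qed.

HB.instance Definition _ (R : realType) :=
  Measure_isProbability.Build _ _ _ (lebesgue01 R) (@lebesgue01_setT R).

Section notions.
Local Open Scope ereal_scope.
Context d (T : measurableType d) (R : realType) (mu : {measure set T -> \bar R}).

Definition equimeasurable (x y : T -> R) : Prop :=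
  forall tau : R, (0 < tau)%R ->
    mu [set t | (tau < `|x t|)%R] = mu [set t | (tau < `|y t|)%R].

Definition independent (f : nat -> T -> R) : Prop :=
  forall (J : {fset nat}) (B : nat -> set R), (forall k, measurable (B k)) ->
    mu (\bigcap_(k in [set` J]) f k @^-1` B k) =
    \prod_(k <- J) mu (f k @^-1` B k).

Definition L2norm (x : T -> R) : \bar R := 'N[mu]_2%:E[EFin \o x].

Definition linear_span (f : nat -> T -> R) : set (T -> R) :=
  [set x | exists (n : nat) (c : nat -> R),
     x = (fun t => \sum_(k < n) c k * f k t)%R].

(* Elements of L^2 are represented by functions, not by classes modulo
   almost-everywhere equality, so the closure is stable under such equality. *)
Definition L2closure (A : set (T -> R)) : set (T -> R) :=
  [set x | x \in Lfun mu 2%:E /\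
     forall e : R, (0 < e)%R -> exists2 y, A y & L2norm (x \- y)%R < e%:E].

Definition closed_linear_span (f : nat -> T -> R) : set (T -> R) :=
  L2closure (linear_span f).

Definition unit_ball (H : set (T -> R)) : set (T -> R) :=
  [set x | H x /\ L2norm x <= 1].

Definition equicontinuous_norms (K : set (T -> R)) : Prop :=
  ereal_sup [set ereal_sup [set L2norm (x \* \1_E)%R | x in K]
            | E in [set E | measurable E /\ mu E < delta%:E]]
    @[delta --> (0 : R)^'+] --> 0.

End notions.

(* Main.v *)
Require Import Defs.
From HB Require Import structures.
From mathcomp Require Import all_boot all_order all_algebra finmap.
From mathcomp Require Import all_classical all_reals all_analysis.
From mathcomp Require Import measurable_realfun ring lra.
Import Order.TTheory GRing.Theory Num.Theory.
Import numFieldNormedType.Exports.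
Set Implicit Arguments.
Unset Strict Implicit.
Unset Printing Implicit Defensive.
Local Open Scope classical_set_scope.
Local Open Scope ring_scope.

(* Write v for the common second moment of the f_k and s for the sum of the
   c_k^2, so that x = sum c_k f_k has squared norm v s. Truncate:
   f_k = h_k + l_k, where h_k is the centered part of f_k lying above the level
   N in absolute value and l_k is bounded by 2 N. Both sequences are again
   independent and centered. Then H = sum c_k h_k has squared norm at most
   s E[f^2 ; |f| > N], which is uniformly small by equimeasurability, while
   L = sum c_k l_k has fourth moment at most 3 (2 N)^4 s^2, so that L^2 is
   uniformly integrable. *)

(** * Orthogonality to the functions of a random variable *)

(** The f_k have only second moments, so a fourth-moment bound is available only after truncation,
    and the two pieces must be centered again for the mixed terms to vanish. The bound 2 N is N for
    the part of f_k below the level plus N for the mean that is added back.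

    Independence is given as a product rule for events, whereas the moment computations need it for
    products of unbounded functions and of powers of partial sums. The bridge is a single
    orthogonality principle: if D has zero integral over every event defined by Y, then E (D Y) = 0.
    Taking for D an indicator minus its probability, or a variable minus its mean, turns product
    rules for events into product rules for expectations without joint laws or product measures. *)

Section expectations.
Context d (T : measurableType d) (R : realType) (P : probability T R).
Implicit Types (D W X Y : T -> R) (A : set T) (B : set R).

Local Notation "''E' X" := (Rintegral P setT X) (at level 10, X at level 8).
Local Notation integr X := (P.-integrable [set: T] (EFin \o X)).

(** Boundedness is required everywhere, not almost everywhere: the class is then visibly closed
    under sums, products and powers, which settles the integrability of every polynomial in the
    truncated variables. *)
Definition bounded_mfun X :=
  measurable_fun [set: T] X /\ exists M : R, forall t, `|X t| <= M.

Lemma bounded_mfun_cst (r : R) : bounded_mfun (fun=> r).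
Proof. by split; [exact: measurable_cst|exists `|r|]. Qed.

Lemma bounded_mfunD X Y :
  bounded_mfun X -> bounded_mfun Y -> bounded_mfun (fun t => X t + Y t).
Proof.
move=> [mX [M XM]] [mY [N YN]]; split; first exact: measurable_funD.
by exists (M + N) => t; rewrite (le_trans (ler_normD _ _))// lerD.
Qed.

Lemma bounded_mfunM X Y :
  bounded_mfun X -> bounded_mfun Y -> bounded_mfun (fun t => X t * Y t).
Proof.
move=> [mX [M XM]] [mY [N YN]]; split; first exact: measurable_funM.
by exists (M * N) => t; rewrite normrM ler_pM.
Qed.

Lemma bounded_mfunX X n : bounded_mfun X -> bounded_mfun (fun t => X t ^+ n).
Proof.
move=> bX; elim: n => [|n IH].
  by under eq_fun do rewrite expr0; exact: bounded_mfun_cst.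
by under eq_fun do rewrite exprS; exact: bounded_mfunM.
Qed.

Lemma bounded_mfun_indic A : measurable A -> bounded_mfun \1_A.
Proof.
move=> mA; split; first exact: measurable_indic.
by exists 1 => t; rewrite indicE; case: (t \in A); rewrite /= ?normr1 ?normr0.
Qed.

Lemma integrable_bounded_mul D X :
  integr D -> bounded_mfun X -> integr (fun t => D t * X t).
Proof.
move=> iD [mX [M XM]].
have mD : measurable_fun [set: T] D.
  exact/measurable_EFinP/(measurable_int P).
have iDM : integr (fun t => D t * M).
  have := integrableZr measurableT M iD.
  by apply: eq_integrable => // t _; rewrite /= EFinM.
apply: le_integrable iDM => //.
  by apply/measurable_EFinP; exact: measurable_funM.
move=> t _; rewrite /= lee_fin !normrM ler_wpM2l//.
by rewrite (le_trans (XM t)) ?ler_norm.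
Qed.

Lemma integrable_cst (r : R) : integr (fun=> r).
Proof. exact: finite_measure_integrable_cst. Qed.

Lemma bounded_mfun_integrable X : bounded_mfun X -> integr X.
Proof.
move=> bX; have := integrable_bounded_mul (integrable_cst 1) bX.
by apply: eq_integrable => // t _ /=; rewrite mul1r.
Qed.

Lemma eq_E X Y : X =1 Y -> 'E X = 'E Y.
Proof. by move=> XY; apply: eq_Rintegral => t _; exact: XY. Qed.

Lemma E_cst (r : R) : 'E (fun=> r) = r.
Proof.
have P1 : P [set: T] = 1%E by exact: probability_setT.
by rewrite Rintegral_cst//= P1 mulr1.
Qed.

Lemma E_indic A : measurable A -> 'E \1_A = fine (P A).
Proof. by move=> mA; rewrite /Rintegral integral_indic// setIT. Qed.

Lemma integrableD_EFin X Y :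
  integr X -> integr Y -> integr (fun t => X t + Y t).
Proof.
move=> iX iY; have := integrableD measurableT iX iY.
by apply: eq_integrable => // t _ /=; rewrite EFinD.
Qed.

Lemma integrableZl_EFin (r : R) X : integr X -> integr (fun t => r * X t).
Proof.
move=> iX; have := integrableZl measurableT r iX.
by apply: eq_integrable => // t _ /=; rewrite EFinM.
Qed.

Lemma indic_preimage (U V : Type) (f : U -> V) (B : set V) (u : U) :
  \1_(f @^-1` B) u = \1_B (f u) :> R.
Proof.
by rewrite !indicE; congr (nat_of_bool _)%:R; apply/idP/idP; rewrite !inE.
Qed.

(* Subtracting [M / 2] on the event [M / 2 <= Y] does not change [E (D Y)] and
   leaves a function of [Y] with values in [[0, M / 2]]. *)
Lemma E_halving D Y (M : R) n : integr D -> measurable_fun [set: T] Y ->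
    (forall B, measurable B -> 'E (fun t => D t * \1_(Y @^-1` B) t) = 0) ->
    (forall t, 0 <= Y t <= M) ->
  `|'E (fun t => D t * Y t)| <= M / 2 ^+ n * 'E (fun t => `|D t|).
Proof.
move=> iD; elim: n Y M => [|n IH] Y M mY D0 YM.
  have iDY : integr (fun t => D t * Y t).
    apply: integrable_bounded_mul => //; split => //.
    by exists M => t; have /andP[Y0 YM'] := YM t; rewrite ger0_norm.
  rewrite expr0 divr1 (le_trans (le_normr_Rintegral _ _))//.
  rewrite -RintegralZl//; last exact: integrable_norm.
  apply: le_Rintegral => //.
  - exact: integrable_norm.
  - by apply: integrableZl_EFin; exact: integrable_norm.
  - move=> t _; have /andP[Y0 YM'] := YM t.
    by rewrite normrM mulrC ler_wpM2r// ger0_norm.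
pose psi (y : R) := y - M / 2 * \1_(`[M / 2, +oo[%classic : set R) y.
have mH : measurable (`[M / 2, +oo[%classic : set R) by exact: measurable_itv.
have mpsi : measurable_fun [set: R] psi.
  apply: measurable_funB => //; apply: measurable_funM => //.
have -> : 'E (fun t => D t * Y t) = 'E (fun t => D t * psi (Y t)).
  have bI : bounded_mfun \1_(Y @^-1` `[M / 2, +oo[%classic).
    by apply: bounded_mfun_indic; rewrite -[X in measurable X]setTI; exact: mY.
  have -> : 'E (fun t => D t * Y t) = 'E (fun t => D t * psi (Y t) +
      M / 2 * (D t * \1_(Y @^-1` `[M / 2, +oo[%classic) t)).
    by apply: eq_E => t; rewrite /psi indic_preimage; ring.
  rewrite RintegralD//.
  - rewrite RintegralZl//; last exact: integrable_bounded_mul.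
    by rewrite D0// mulr0 addr0.
  - apply: integrable_bounded_mul => //; split; first exact: measurableT_comp.
    exists (M + M) => t; have /andP[Y0 YM'] := YM t.
    rewrite /psi indicE; case: (_ \in _); rewrite ?mulr1 ?mulr0.
      by rewrite ler_norml; apply/andP; split; lra.
    by rewrite subr0 ger0_norm//; lra.
  - by apply: integrableZl_EFin; exact: integrable_bounded_mul.
have -> : M / 2 ^+ n.+1 = M / 2 / 2 ^+ n.
  by rewrite exprS invfM mulrA.
apply: IH; first exact: measurableT_comp.
  move=> B mB; rewrite -[X in \1_X]/((psi \o Y) @^-1` B) comp_preimage.
  by apply: D0; rewrite -[X in measurable X]setTI; exact: mpsi.
move=> t; have /andP[Y0 YM'] := YM t.
rewrite /psi indicE mem_setE in_itv/= andbT.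
by have [h|h] := leP (M / 2) (Y t); rewrite /= ?mulr1 ?mulr0 ?subr0;
  apply/andP; split; lra.
Qed.

(** The event for [setT] gives E D = 0, so Y may be shifted by M to take values in [0, 2 M]. The
    halving bound then holds for every n and tends to 0. *)
Lemma E_mul_bounded_eq0 D Y : integr D -> bounded_mfun Y ->
    (forall B, measurable B -> 'E (fun t => D t * \1_(Y @^-1` B) t) = 0) ->
  'E (fun t => D t * Y t) = 0.
Proof.
move=> iD [mY [M YM]] D0.
have bY : bounded_mfun Y by split => //; exists M.
have ED0 : 'E D = 0.
  rewrite -[RHS](D0 setT)//; apply: eq_E => t.
  by rewrite preimage_setT indicT mulr1.
have -> : 'E (fun t => D t * Y t) = 'E (fun t => D t * (Y t + M)).
  have -> : 'E (fun t => D t * (Y t + M)) = 'E (fun t => D t * Y t + M * D t).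
    by apply: eq_E => t; ring.
  rewrite RintegralD// ?RintegralZl// ?ED0 ?mulr0 ?addr0//.
    exact: integrable_bounded_mul.
  exact: integrableZl_EFin.
have bound n : `|'E (fun t => D t * (Y t + M))| <=
    (M + M) * 'E (fun t => `|D t|) * geometric 1 2^-1 n.
  rewrite /= mul1r exprVn mulrAC.
  apply: E_halving => //.
  - exact: measurable_funD.
  - move=> B mB; rewrite -[X in \1_X]/(((fun y => y + M) \o Y) @^-1` B).
    rewrite comp_preimage; apply: D0.
    rewrite -[X in measurable X]setTI.
    have mS : measurable_fun [set: R] (fun y : R => y + M).
      exact: measurable_funD.
    exact: mS.
  - by move=> t; have := YM t; rewrite ler_norml => /andP[? ?]; lra.
apply/eqP; rewrite -normr_le0.
have h : (M + M) * 'E (fun t => `|D t|) * geometric 1 2^-1 n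
    @[n --> \oo] --> (0 : R).
  rewrite -[0](mulr0 ((M + M) * 'E (fun t => `|D t|))).
  apply: cvgM; first exact: cvg_cst.
  apply: cvg_geometric; rewrite ger0_norm//; lra.
rewrite -(cvg_lim _ h)//; apply: limr_ge; first by apply/cvg_ex; exists 0.
exact: nearW.
Qed.

(** Y is replaced by 0 where it exceeds n in absolute value. The result is still a function of Y,
    hence inherits the orthogonality, and dominated convergence with majorant |D Y| removes the
    cutoff. *)
Lemma E_mul_eq0 D Y : integr D -> measurable_fun [set: T] Y ->
    integr (fun t => D t * Y t) ->
    (forall B, measurable B -> 'E (fun t => D t * \1_(Y @^-1` B) t) = 0) ->
  'E (fun t => D t * Y t) = 0.
Proof.
move=> iD mY iDY D0.
have mD : measurable_fun [set: T] D.
  exact/measurable_EFinP/(measurable_int P).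
pose trunc n (y : R) := y * \1_(`[- n%:R, n%:R]%classic : set R) y.
have mtrunc n : measurable_fun [set: R] (trunc n).
  by apply: measurable_funM => //; exact: measurable_indic.
have E0 n : 'E (fun t => D t * trunc n (Y t)) = 0.
  apply: E_mul_bounded_eq0 => //.
    split; first exact: measurableT_comp.
    exists n%:R => t; rewrite /trunc indicE mem_setE in_itv/=.
    by case: andP => [/andP ?|_]; rewrite ?mulr1 ?mulr0 ?normr0// ler_norml.
  move=> B mB; rewrite -[X in \1_X]/((trunc n \o Y) @^-1` B) comp_preimage.
  by apply: D0; rewrite -[X in measurable X]setTI; exact: mtrunc.
have cvgE : (fun n => \int[P]_t (D t * trunc n (Y t))%:E)%E @ \oo -->
    (\int[P]_t (D t * Y t)%:E)%E.
  have [] := @dominated_convergence _ _ _ P setT measurableT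
    (fun n t => (D t * trunc n (Y t))%:E) (fun t => (D t * Y t)%:E)
    (fun t => (`|D t * Y t|)%:E) => //.
  - move=> n; apply/measurable_EFinP; apply: measurable_funM => //.
    exact: measurableT_comp.
  - by apply/measurable_EFinP; exact: measurable_funM.
  - apply: aeW => t _; apply: cvg_near_cst; near=> n.
    rewrite /trunc indicE mem_set ?mulr1//= in_itv/= -ler_norml.
    by near: n; exact: nbhs_infty_ger.
  - exact: (integrable_norm iDY).
  - apply: aeW => t n _; rewrite /= lee_fin /trunc indicE mulrA normrM.
    by case: (_ \in _); rewrite /= ?normr1 ?normr0 ?mulr1 ?mulr0.
have E0' : (fun n => (\int[P]_t (D t * trunc n (Y t))%:E)%E) = fun=> 0%E.
  apply/funext => n; rewrite -[LHS]fineK; first by rewrite [fine _]E0.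
  apply: integrable_fin_num => //; apply: integrable_bounded_mul => //.
    split; first exact: measurableT_comp.
    exists n%:R => t; rewrite /trunc indicE mem_setE in_itv/=.
    by case: andP => [/andP ?|_]; rewrite ?mulr1 ?mulr0 ?normr0// ler_norml.
rewrite E0' in cvgE.
rewrite /Rintegral -(cvg_lim _ cvgE)//.
by rewrite lim_cst.
Unshelve. all: by end_near. Qed.

End expectations.

(** * Independent square-integrable variables *)

Section independence.
Context d (T : measurableType d) (R : realType) (P : probability T R).
Implicit Types (D W X Y : T -> R) (A : set T) (B : set R).

Local Notation "''E' X" := (Rintegral P setT X) (at level 10, X at level 8).
Local Notation integr X := (P.-integrable [set: T] (EFin \o X)).

Lemma Lfun2_measurable X : X \in Lfun P 2%:E -> measurable_fun [set: T] X.
Proof. by move=> /andP[/[!inE]]. Qed.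

Lemma Lfun2_intro X : measurable_fun [set: T] X ->
  integr (fun t => X t ^+ 2) -> X \in Lfun P 2%:E.
Proof.
move=> mX /integrableP[_ iX]; apply/andP; split; rewrite inE//=.
rewrite /finite_norm unlock poweR_lty//; apply: le_lt_trans iX.
under eq_integral do rewrite /= powR_mulrn//.
by under [leRHS]eq_integral do rewrite /= normrX.
Qed.

Lemma L2norm_sqrt X : X \in Lfun P 2%:E ->
  L2norm P X = (Num.sqrt ('E (fun t => X t ^+ 2)))%:E.
Proof.
move=> l2X; rewrite /L2norm unlock.
have -> : (\int[P]_t `|(EFin \o X) t| `^ 2 = ('E (fun t => X t ^+ 2))%:E)%E.
  rewrite /Rintegral fineK; last first.
    by apply: integrable_fin_num => //; exact: Lfun2_integrable_sqr.
  by apply: eq_integral => t _; rewrite /= powR_mulrn// real_normK// num_real.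
rewrite poweR_EFin; congr EFin.
by rewrite powR12_sqrt// Rintegral_ge0// => t _; exact: sqr_ge0.
Qed.

Lemma Lfun2_integrable X : X \in Lfun P 2%:E -> integr X.
Proof.
move=> l2X; apply/Lfun1_integrable; apply: Lfun_subset12 => //.
exact: fin_num_measure.
Qed.

Lemma Lfun2_integrableM X Y : X \in Lfun P 2%:E -> Y \in Lfun P 2%:E ->
  integr (fun t => X t * Y t).
Proof. by move=> l2X l2Y; apply/Lfun1_integrable; exact: Lfun2_mul_Lfun1. Qed.

Lemma Lfun2_bounded X : bounded_mfun X -> X \in Lfun P 2%:E.
Proof.
move=> bX; apply: Lfun2_intro; first by case: bX.
by apply: bounded_mfun_integrable; exact: bounded_mfunX.
Qed.

Lemma Lfun2D X Y : X \in Lfun P 2%:E -> Y \in Lfun P 2%:E ->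
  (fun t => X t + Y t) \in Lfun P 2%:E.
Proof. by move=> l2X l2Y; apply: (Lfun_addr_closed P (lee1n 2)).2. Qed.

Lemma Lfun2Z (c : R) X : X \in Lfun P 2%:E ->
  (fun t => c * X t) \in Lfun P 2%:E.
Proof.
move=> l2X; under eq_fun do rewrite mulrC.
by apply: (@Lfun_scale _ _ _ P X c 2) => //; rewrite ler1n.
Qed.

Lemma Lfun2B X Y : X \in Lfun P 2%:E -> Y \in Lfun P 2%:E ->
  (fun t => X t - Y t) \in Lfun P 2%:E.
Proof.
move=> l2X l2Y; have := Lfun2D l2X (Lfun2Z (-1) l2Y).
by under eq_fun do rewrite mulN1r.
Qed.

Lemma Lfun2M_bounded X Y : X \in Lfun P 2%:E -> bounded_mfun Y ->
  (fun t => X t * Y t) \in Lfun P 2%:E.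
Proof.
move=> l2X bY; have mX := Lfun2_measurable l2X.
apply: Lfun2_intro; first by apply: measurable_funM => //; case: bY.
under eq_fun do rewrite exprMn.
apply: integrable_bounded_mul; first exact: Lfun2_integrable_sqr.
exact: bounded_mfunX.
Qed.

Lemma Lfun2_sum n (c : nat -> R) (g : nat -> T -> R) :
  (forall k, g k \in Lfun P 2%:E) ->
  (fun t => \sum_(k < n) c k * g k t) \in Lfun P 2%:E.
Proof.
move=> l2g; elim: n => [|n IH].
  under eq_fun do rewrite big_ord0.
  by apply: Lfun2_bounded; exact: bounded_mfun_cst.
under eq_fun do rewrite big_ord_recr/=.
by apply: Lfun2D => //; exact: Lfun2Z.
Qed.

Lemma E_sqrD_le X Y : X \in Lfun P 2%:E -> Y \in Lfun P 2%:E ->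
  'E (fun t => (X t + Y t) ^+ 2) <=
  2 * 'E (fun t => X t ^+ 2) + 2 * 'E (fun t => Y t ^+ 2).
Proof.
move=> l2X l2Y; rewrite -!RintegralZl -?RintegralD//;
  try exact: Lfun2_integrable_sqr;
  try by apply: integrableZl_EFin; exact: Lfun2_integrable_sqr.
apply: le_Rintegral => //.
- by apply: Lfun2_integrable_sqr; exact: Lfun2D.
- by apply: integrableD_EFin; apply: integrableZl_EFin;
    exact: Lfun2_integrable_sqr.
- by move=> t _; have := sqr_ge0 (X t - Y t); lra.
Qed.

Lemma independent_comp (g : nat -> T -> R) (phi : nat -> R -> R) :
  (forall k, measurable_fun [set: R] (phi k)) ->
  independent P g -> independent P (fun k t => phi k (g k t)).
Proof.
move=> mphi Ig J B mB; apply: (Ig J (fun k => phi k @^-1` B k)) => k.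
by rewrite -[X in measurable X]setTI; exact: mphi.
Qed.

Lemma independent_pair (g : nat -> T -> R) j k B C : independent P g ->
  j != k -> measurable B -> measurable C ->
  (P (g j @^-1` B `&` g k @^-1` C) = P (g j @^-1` B) * P (g k @^-1` C))%E.
Proof.
move=> Ig jk mB mC.
have := Ig [fset j; k]%fset (fun i => if i == j then B else C).
rewrite (_ : [set` [fset j; k]%fset] = [set j; k]); last first.
  apply/seteqP; split => i /=; rewrite !inE.
    by move=> /orP[]/eqP->; [left|right].
  by case=> ->; rewrite eqxx ?orbT.
rewrite bigcap_setU !bigcap_set1 eqxx eq_sym (negbTE jk).
rewrite big_fsetU1 ?inE//= big_seq_fset1 eqxx eq_sym (negbTE jk).
by apply => i; case: ifP.
Qed.

(** The orthogonality principle is used twice. Against functions of X it reduces the claim to E (Y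
    1_{X in B}) = 0. As E Y = 0, this equals E (D Y) with D = 1_{X in B} - P (X in B), and against
    functions of Y the principle asks only for E (D 1_{Y in C}) = 0, which is the product rule for
    events. *)
Lemma E_mul_indep_eq0 X Y : X \in Lfun P 2%:E -> Y \in Lfun P 2%:E ->
    (forall B C, measurable B -> measurable C ->
      P (X @^-1` B `&` Y @^-1` C) = P (X @^-1` B) * P (Y @^-1` C))%E ->
    'E Y = 0 ->
  'E (fun t => X t * Y t) = 0.
Proof.
move=> l2X l2Y XY EY0.
have mX := Lfun2_measurable l2X; have mY := Lfun2_measurable l2Y.
have mXB B : measurable B -> measurable (X @^-1` B).
  by move=> mB; rewrite -[X in measurable X]setTI; exact: mX.
have mYB B : measurable B -> measurable (Y @^-1` B).
  by move=> mB; rewrite -[X in measurable X]setTI; exact: mY.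
have -> : 'E (fun t => X t * Y t) = 'E (fun t => Y t * X t).
  by apply: eq_E => t; rewrite mulrC.
apply: E_mul_eq0 => //.
- exact: Lfun2_integrable.
- exact: Lfun2_integrableM.
move=> B mB.
pose D t : R := \1_(X @^-1` B) t - fine (P (X @^-1` B)).
have bD : bounded_mfun D.
  apply: bounded_mfunD; last exact: bounded_mfun_cst.
  by apply: bounded_mfun_indic; exact: mXB.
have bI C : measurable C -> bounded_mfun (\1_C : T -> R).
  exact: bounded_mfun_indic.
suff : 'E (fun t => D t * Y t) = 0.
  have -> : 'E (fun t => D t * Y t) = 'E (fun t =>
      Y t * \1_(X @^-1` B) t + - fine (P (X @^-1` B)) * Y t).
    by apply: eq_E => t; rewrite /D; ring.
  have iY := Lfun2_integrable l2Y.
  rewrite RintegralD//; last exact: integrableZl_EFin.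
    by rewrite RintegralZl// EY0 mulr0 addr0.
  by apply: integrable_bounded_mul => //; apply: bI; exact: mXB.
apply: E_mul_eq0 => //.
- exact: bounded_mfun_integrable.
- by apply: Lfun2_integrableM => //; exact: Lfun2_bounded.
move=> C mC.
have -> : 'E (fun t => D t * \1_(Y @^-1` C) t) = 'E (fun t =>
    \1_(X @^-1` B `&` Y @^-1` C) t + - fine (P (X @^-1` B)) * \1_(Y @^-1` C) t).
  by apply: eq_E => t; rewrite /D indicI; rewrite /=; ring.
have mI := measurableI _ _ (mXB _ mB) (mYB _ mC).
rewrite RintegralD//; last 2 first.
- by apply: bounded_mfun_integrable; exact: bI.
- by apply/integrableZl_EFin/bounded_mfun_integrable/bI; exact: mYB.
rewrite RintegralZl//; last by apply/bounded_mfun_integrable/bI; exact: mYB.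
rewrite !E_indic//; [|exact: mYB].
rewrite XY// fineM ?fin_num_measure//; [|exact: mXB|exact: mYB].
by rewrite mulNr subrr.
Qed.

Lemma E_sqr_lincomb n (c : nat -> R) (g : nat -> T -> R) :
  (forall k, g k \in Lfun P 2%:E) -> (forall k, 'E (g k) = 0) ->
  independent P g ->
  'E (fun t => (\sum_(k < n) c k * g k t) ^+ 2) =
  \sum_(k < n) c k ^+ 2 * 'E (fun t => g k t ^+ 2).
Proof.
move=> l2g Eg Ig.
(* Letting m run up to k makes the sum grow one term at a time while [g k] stays fixed; the case
   used below is m = k = n. *)
have cross m k : (m <= k)%N ->
    'E (fun t => (\sum_(j < m) c j * g j t) * g k t) = 0.
  elim: m => [|m IH] mk.
    rewrite -[RHS](E_cst P 0); apply: eq_E => t.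
    by rewrite big_ord0 mul0r.
  have -> : 'E (fun t => (\sum_(j < m.+1) c j * g j t) * g k t) =
      'E (fun t => (\sum_(j < m) c j * g j t) * g k t + c m * (g m t * g k t)).
    by apply: eq_E => t; rewrite big_ord_recr/=; ring.
  rewrite RintegralD//; last 2 first.
  - by apply: Lfun2_integrableM => //; exact: Lfun2_sum.
  - by apply: integrableZl_EFin; exact: Lfun2_integrableM.
  rewrite IH ?(ltnW mk)// RintegralZl//; last exact: Lfun2_integrableM.
  rewrite E_mul_indep_eq0 ?mulr0 ?addr0// => B C mB mC.
  by apply: independent_pair => //; rewrite ltn_eqF.
elim: n => [|n IH].
  rewrite big_ord0 -[RHS](E_cst P 0); apply: eq_E => t.
  by rewrite big_ord0 expr0n.
have -> : 'E (fun t => (\sum_(k < n.+1) c k * g k t) ^+ 2) =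
    'E (fun t => ((\sum_(k < n) c k * g k t) ^+ 2 +
      2 * c n * ((\sum_(k < n) c k * g k t) * g n t)) + c n ^+ 2 * g n t ^+ 2).
  by apply: eq_E => t; rewrite big_ord_recr/=; ring.
have l2S := Lfun2_sum n c l2g.
rewrite RintegralD//; last 2 first.
- apply: integrableD_EFin; first exact: Lfun2_integrable_sqr.
  by apply: integrableZl_EFin; exact: Lfun2_integrableM.
- by apply: integrableZl_EFin; exact: Lfun2_integrable_sqr.
rewrite RintegralD//; last 2 first.
- exact: Lfun2_integrable_sqr.
- by apply: integrableZl_EFin; exact: Lfun2_integrableM.
rewrite RintegralZl//; last exact: Lfun2_integrableM.
rewrite RintegralZl//; last exact: Lfun2_integrable_sqr.
by rewrite cross// mulr0 addr0 IH big_ord_recr.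
Qed.

End independence.

(** * Fourth moment of a sum of independent bounded variables *)

Section fourth_moment.
Context d (T : measurableType d) (R : realType) (P : probability T R).
Variable g : nat -> T -> R.
Implicit Types (D W X Y : T -> R) (A : set T) (B : nat -> set R).

Local Notation "''E' X" := (Rintegral P setT X) (at level 10, X at level 8).
Local Notation integr X := (P.-integrable [set: T] (EFin \o X)).
Local Notation cylinder J B := (\bigcap_(k in [set` J]) g k @^-1` B k).

(* This class contains the constants, is linear, and multiplication by a power
   of [g n] maps it at [n] into it at [n.+1]; hence it contains the powers of
   linear combinations of [g 0], ..., [g n.-1], without having to identify the
   sigma-algebra these generate. *)
Definition indep_of_tail n W := bounded_mfun W /\
  forall (J : {fset nat}) B, (forall k, measurable (B k)) ->
    (forall k, k \in J -> (n <= k)%N) ->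
  'E (fun t => W t * \1_(cylinder J B) t) = 'E W * fine (P (cylinder J B)).

Hypothesis mg : forall k, measurable_fun [set: T] (g k).
Hypothesis Ig : independent P g.

Lemma measurable_cylinder (J : {fset nat}) B :
  (forall k, measurable (B k)) -> measurable (cylinder J B).
Proof.
move=> mB; apply: bigcap_measurableType => k _.
by rewrite -[X in measurable X]setTI; exact: mg.
Qed.

Let bI (J : {fset nat}) B :
  (forall k, measurable (B k)) -> bounded_mfun (\1_(cylinder J B) : T -> R).
Proof. by move=> mB; apply: bounded_mfun_indic; exact: measurable_cylinder. Qed.

Lemma indep_of_tail_cst n (r : R) : indep_of_tail n (fun=> r).
Proof.
split; first exact: bounded_mfun_cst.
move=> J B mB _; rewrite RintegralZl//; last exact/bounded_mfun_integrable/bI.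
by rewrite E_indic ?E_cst//; exact: measurable_cylinder.
Qed.

Lemma indep_of_tailD n W X : indep_of_tail n W -> indep_of_tail n X ->
  indep_of_tail n (fun t => W t + X t).
Proof.
move=> [bW IW] [bX IX]; split; first exact: bounded_mfunD.
move=> J B mB Jn.
have iWI := bounded_mfun_integrable P (bounded_mfunM bW (bI J mB)).
have iXI := bounded_mfun_integrable P (bounded_mfunM bX (bI J mB)).
have -> : 'E (fun t => (W t + X t) * \1_(cylinder J B) t) = 'E (fun t =>
    W t * \1_(cylinder J B) t + X t * \1_(cylinder J B) t).
  by apply: eq_E => t; rewrite mulrDl.
rewrite [LHS]RintegralD// IW// IX// RintegralD ?mulrDl//;
  exact: bounded_mfun_integrable.
Qed.

Lemma indep_of_tailZ n (c : R) W : indep_of_tail n W ->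
  indep_of_tail n (fun t => c * W t).
Proof.
move=> [bW IW]; split.
  by apply: bounded_mfunM => //; exact: bounded_mfun_cst.
move=> J B mB Jn.
have iWI := bounded_mfun_integrable P (bounded_mfunM bW (bI J mB)).
have -> : 'E (fun t => c * W t * \1_(cylinder J B) t) =
    'E (fun t => c * (W t * \1_(cylinder J B) t)).
  by apply: eq_E => t; rewrite mulrA.
rewrite RintegralZl// IW// RintegralZl ?mulrA//.
exact: bounded_mfun_integrable.
Qed.

(** Since all indices in J exceed n, a condition on [g n] can be added without disturbing those on
    J. An event of [g n] intersected with a later cylinder is thus again a cylinder of the tail from
    n, to which [indep_of_tail n] applies. *)
Lemma cylinder1U n (J : {fset nat}) B C : (forall k, k \in J -> (n < k)%N) ->
  cylinder (n |` J)%fset (fun k => if k == n then C else B k) =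
  g n @^-1` C `&` cylinder J B.
Proof.
move=> Jn; apply/seteqP; split => t /=.
- move=> h; split; first by have := h n; rewrite /= !inE eqxx; apply.
  move=> k /= kJ; have := h k; rewrite /= !inE kJ orbT => /(_ isT).
  by rewrite gtn_eqF// Jn.
- move=> [tC h] k /=; rewrite !inE; case: eqP => [->//|_ /= kJ].
  exact: h.
Qed.

Lemma measure_cylinder1U n (J : {fset nat}) B C :
  (forall k, k \in J -> (n < k)%N) -> (forall k, measurable (B k)) ->
  measurable C ->
  fine (P (g n @^-1` C `&` cylinder J B)) =
  fine (P (g n @^-1` C)) * fine (P (cylinder J B)).
Proof.
move=> Jn mB mC; rewrite -cylinder1U//.
have nJ : n \notin J by apply/negP => /Jn; rewrite ltnn.
have mBC k : measurable (if k == n then C else B k) by case: ifP.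
rewrite Ig// big_fsetU1//= eqxx fineM; last 2 first.
- apply: fin_num_measure; rewrite -[X in measurable X]setTI; exact: mg.
- rewrite -Ig//; apply: fin_num_measure; exact: measurable_cylinder.
congr (_ * fine _); rewrite [RHS]Ig//.
rewrite big_seq [RHS]big_seq; apply: eq_bigr => k kJ.
by rewrite gtn_eqF// Jn.
Qed.

Lemma indep_of_tail_integral1U n W (J : {fset nat}) B C :
  indep_of_tail n W -> (forall k, k \in J -> (n < k)%N) ->
  (forall k, measurable (B k)) -> measurable C ->
  'E (fun t => W t * \1_(g n @^-1` C `&` cylinder J B) t) =
  'E W * (fine (P (g n @^-1` C)) * fine (P (cylinder J B))).
Proof.
move=> [bW IW] Jn mB mC; rewrite -measure_cylinder1U// -cylinder1U//.
apply: IW => [k|k]; first by case: ifP.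
by rewrite !inE => /predU1P[->//|/Jn/ltnW].
Qed.

Lemma indep_of_tail_integral1 n W C : indep_of_tail n W -> measurable C ->
  'E (fun t => W t * \1_(g n @^-1` C) t) = 'E W * fine (P (g n @^-1` C)).
Proof.
move=> IW mC.
have := @indep_of_tail_integral1U n W fset0 (fun=> setT) C IW.
have -> : cylinder fset0 (fun=> setT : set R) = setT.
  by apply/seteqP; split => // t _ k.
rewrite setIT probability_setT mulr1; apply=> //.
Qed.

Hypothesis bg : forall k, bounded_mfun (g k).

Lemma E_mulX_eq0 n D b : bounded_mfun D ->
    (forall C, measurable C -> 'E (fun t => D t * \1_(g n @^-1` C) t) = 0) ->
  'E (fun t => D t * g n t ^+ b) = 0.
Proof.
move=> bD D0; apply: E_mul_bounded_eq0.
- exact: bounded_mfun_integrable.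
- exact: bounded_mfunX.
move=> C mC; apply: (D0 ((fun y : R => y ^+ b) @^-1` C)).
by rewrite -[X in measurable X]setTI; exact: exprn_measurable.
Qed.

(** With p the probability of the cylinder, D = W (1_cylinder - p) has zero integral over every
    event of [g n]: both terms equal E W times p times the probability of that event. So D is
    orthogonal to the powers of [g n], which is the claim after expanding D. *)
Lemma indep_of_tail_mulX n W b : indep_of_tail n W ->
  indep_of_tail n.+1 (fun t => W t * g n t ^+ b).
Proof.
move=> IW; have [bW _] := IW.
have bY : bounded_mfun (fun t => g n t ^+ b) by exact: bounded_mfunX.
split; first exact: bounded_mfunM.
move=> J B mB Jn; set p := fine (P _).
have bIJ := bI J mB.
pose D t := W t * (\1_(cylinder J B) t - p).
have bD : bounded_mfun D.
  apply: bounded_mfunM => //; apply: bounded_mfunD => //.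
  exact: bounded_mfun_cst.
have : 'E (fun t => D t * g n t ^+ b) = 0.
  apply: E_mulX_eq0 => // C mC.
  have mgC : measurable (g n @^-1` C).
    by rewrite -[X in measurable X]setTI; exact: mg.
  have bIC : bounded_mfun (\1_(g n @^-1` C) : T -> R).
    exact: bounded_mfun_indic.
  have -> : 'E (fun t => D t * \1_(g n @^-1` C) t) = 'E (fun t =>
      W t * \1_(g n @^-1` C `&` cylinder J B) t
      + - p * (W t * \1_(g n @^-1` C) t)).
    by apply: eq_E => t; rewrite /D indicI/=; ring.
  rewrite RintegralD//; last 2 first.
  - apply/bounded_mfun_integrable/bounded_mfunM => //.
    apply: bounded_mfun_indic; apply: measurableI => //.
    exact: measurable_cylinder.
  - by apply/integrableZl_EFin/bounded_mfun_integrable/bounded_mfunM.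
  rewrite RintegralZl//; last by apply/bounded_mfun_integrable/bounded_mfunM.
  by rewrite indep_of_tail_integral1U// indep_of_tail_integral1// -/p; ring.
have -> : 'E (fun t => D t * g n t ^+ b) = 'E (fun t =>
    W t * g n t ^+ b * \1_(cylinder J B) t + - p * (W t * g n t ^+ b)).
  by apply: eq_E => t; rewrite /D; ring.
have iWY := bounded_mfun_integrable P (bounded_mfunM bW bY).
rewrite RintegralD//; last 2 first.
- exact: integrable_bounded_mul.
- exact: integrableZl_EFin.
rewrite RintegralZl// => h; lra.
Qed.

(** Here the variable orthogonal to the events of [g n] is W - E W. *)
Lemma E_mulX_indep_of_tail n W b : indep_of_tail n W ->
  'E (fun t => W t * g n t ^+ b) = 'E W * 'E (fun t => g n t ^+ b).
Proof.
move=> IW; have [bW _] := IW.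
have bY : bounded_mfun (fun t => g n t ^+ b) by exact: bounded_mfunX.
pose D t := W t - 'E W.
have bD : bounded_mfun D by apply: bounded_mfunD => //; exact: bounded_mfun_cst.
have : 'E (fun t => D t * g n t ^+ b) = 0.
  apply: E_mulX_eq0 => // C mC.
  have mgC : measurable (g n @^-1` C).
    by rewrite -[X in measurable X]setTI; exact: mg.
  have bIC : bounded_mfun (\1_(g n @^-1` C) : T -> R).
    exact: bounded_mfun_indic.
  have -> : 'E (fun t => D t * \1_(g n @^-1` C) t) = 'E (fun t =>
      W t * \1_(g n @^-1` C) t + - 'E W * \1_(g n @^-1` C) t).
    by apply: eq_E => t; rewrite /D; ring.
  rewrite RintegralD//; last 2 first.
  - by apply/bounded_mfun_integrable/bounded_mfunM.
  - by apply/integrableZl_EFin/bounded_mfun_integrable.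
  rewrite RintegralZl//; last exact/bounded_mfun_integrable.
  by rewrite indep_of_tail_integral1// E_indic//; ring.
have -> : 'E (fun t => D t * g n t ^+ b) = 'E (fun t =>
    W t * g n t ^+ b + - 'E W * g n t ^+ b).
  by apply: eq_E => t; rewrite /D; ring.
have iY := bounded_mfun_integrable P bY.
rewrite RintegralD//; last 2 first.
- by apply/bounded_mfun_integrable/bounded_mfunM.
- exact: integrableZl_EFin.
rewrite RintegralZl// => h; lra.
Qed.

Variable c : nat -> R.
Let S n t := \sum_(k < n) c k * g k t.

Let SS n t : S n.+1 t = S n t + c n * g n t.
Proof. by rewrite /S big_ord_recr. Qed.

Lemma indep_of_tail_lincombX n a : indep_of_tail n (fun t => S n t ^+ a).
Proof.
elim: n a => [|n IH] a.
  rewrite (_ : (fun _ => _) = fun=> 0 ^+ a); first exact: indep_of_tail_cst.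
  by apply/funext => t; rewrite /S big_ord0.
(* The extra factors absorb the expansion of one factor of the power at a
   time, which avoids the binomial formula. *)
suff H : forall i j,
    indep_of_tail n.+1 (fun t => S n.+1 t ^+ a * (S n t ^+ i * g n t ^+ j)).
  by have := H 0 0; under eq_fun do rewrite !expr0 !mulr1.
elim: a => [|a IHa] i j.
  by under eq_fun do rewrite expr0 mul1r; exact: indep_of_tail_mulX.
rewrite (_ : (fun _ => _) = fun t =>
    S n.+1 t ^+ a * (S n t ^+ i.+1 * g n t ^+ j) +
    c n * (S n.+1 t ^+ a * (S n t ^+ i * g n t ^+ j.+1))).
  by apply: indep_of_tailD => //; exact: indep_of_tailZ.
apply/funext => t; rewrite !exprS [X in X * _ ^+ a]SS; ring.
Qed.

Variable M : R.
Hypothesis gM : forall k t, `|g k t| <= M.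
Hypothesis Eg : forall k, 'E (g k) = 0.

Let bS n : bounded_mfun (S n).
Proof.
by have [] := indep_of_tail_lincombX n 1; under eq_fun do rewrite expr1.
Qed.

Let E_bound Y r : bounded_mfun Y -> (forall t, Y t <= r) -> 'E Y <= r.
Proof.
move=> bY Yr; rewrite -(E_cst P r); apply: le_Rintegral => //.
- exact: bounded_mfun_integrable.
- exact: integrable_cst.
Qed.

Lemma E_sqr_lincomb_le n :
  'E (fun t => S n t ^+ 2) <= M ^+ 2 * \sum_(k < n) c k ^+ 2.
Proof.
rewrite E_sqr_lincomb//; last by move=> k; exact: Lfun2_bounded.
rewrite mulr_sumr; apply: ler_sum => k _; rewrite mulrC.
apply: ler_wpM2r; first exact: sqr_ge0.
apply: E_bound; first exact: bounded_mfunX.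
move=> t; rewrite -[leLHS]real_normK ?num_real// lerXn2r ?nnegrE//.
exact: le_trans (gM k t).
Qed.

Lemma E_lincomb n : 'E (S n) = 0.
Proof.
elim: n => [|n IH].
  by rewrite -[RHS](E_cst P 0); apply: eq_E => t; rewrite /S big_ord0.
have -> : 'E (S n.+1) = 'E (fun t => S n t + c n * g n t) by exact: eq_E.
have ig := bounded_mfun_integrable P (bg n).
rewrite RintegralD// ?RintegralZl// ?IH ?Eg ?mulr0 ?addr0//.
- exact: bounded_mfun_integrable.
- exact: integrableZl_EFin.
Qed.

(** In the expansion of (S + c g)^4 the terms S^3 g and S g^3 vanish because g and S are centered.
    What remains is at most M^4 (3 s^2 + 6 s c^2 + c^4), and the constant 3 is the one for which 3
    (s + c^2)^2 reproduces the mixed term 6 s c^2 exactly and leaves room for c^4. *)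
Lemma E_pow4_lincomb_le n :
  'E (fun t => S n t ^+ 4) <= 3 * M ^+ 4 * (\sum_(k < n) c k ^+ 2) ^+ 2.
Proof.
elim: n => [|n IH].
  rewrite big_ord0 expr0n/= mulr0 -[leRHS](E_cst P 0) le_eqVlt.
  by apply/orP; left; apply/eqP/eq_E => t; rewrite /S big_ord0 expr0n.
have iSg a b : integr (fun t => S n t ^+ a * g n t ^+ b).
  by apply/bounded_mfun_integrable/bounded_mfunM; exact: bounded_mfunX.
(* The exponents 0 and 1 are written out so that one factorization rule covers all five terms. *)
have -> : 'E (fun t => S n.+1 t ^+ 4) = 'E (fun t =>
    S n t ^+ 4 * g n t ^+ 0 + 4 * c n * (S n t ^+ 3 * g n t ^+ 1)
    + 6 * c n ^+ 2 * (S n t ^+ 2 * g n t ^+ 2)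
    + 4 * c n ^+ 3 * (S n t ^+ 1 * g n t ^+ 3)
    + c n ^+ 4 * (S n t ^+ 0 * g n t ^+ 4)).
  by apply: eq_E => t; rewrite SS; ring.
rewrite !RintegralD//; do ?[exact: integrableZl_EFin
  |apply: integrableD_EFin => //].
have EE a b := E_mulX_indep_of_tail b (indep_of_tail_lincombX n a).
do 4![rewrite RintegralZl//]; rewrite !EE.
have E0 X : 'E (fun t => X t ^+ 0) = 1.
  by rewrite -[RHS](E_cst P 1); exact: eq_E.
have E1 X : 'E (fun t => X t ^+ 1) = 'E X by exact: eq_E.
rewrite !E0 (E1 (S n)) (E1 (g n)) Eg E_lincomb.
rewrite !mulr0 !mul0r !mulr1 mul1r !mulr0 !addr0.
rewrite big_ord_recr/=; set s := \sum_(k < n) c k ^+ 2.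
have s0 : 0 <= s by apply: sumr_ge0 => k _; exact: sqr_ge0.
have gk k : 'E (fun t => g n t ^+ k.*2) <= M ^+ k.*2.
  apply: E_bound; first exact: bounded_mfunX.
  move=> t; rewrite (le_trans (ler_norm _))// normrX lerXn2r ?nnegrE//.
  exact: le_trans (gM n t).
have S2 := E_sqr_lincomb_le n; rewrite -/s in S2.
have S20 : 0 <= 'E (fun t => S n t ^+ 2).
  by apply: Rintegral_ge0 => t _; exact: sqr_ge0.
have g20 : 0 <= 'E (fun t => g n t ^+ 2).
  by apply: Rintegral_ge0 => t _; exact: sqr_ge0.
have h2 : 'E (fun t => S n t ^+ 2) * 'E (fun t => g n t ^+ 2) <=
    M ^+ 2 * s * M ^+ 2 by apply: ler_pM => //; exact: (gk 1%N).
have h4 : c n ^+ 4 * 'E (fun t => g n t ^+ 4) <= c n ^+ 4 * M ^+ 4.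
  by apply: ler_wpM2l (gk 2%N); rewrite (_ : 4%N = (2 * 2)%N)// exprM sqr_ge0.
have h2' := ler_wpM2l (sqr_ge0 (c n)) h2.
have h5 : 0 <= c n ^+ 4 * M ^+ 4.
  by rewrite -exprMn (_ : 4%N = (2 * 2)%N)// exprM sqr_ge0.
apply: (@le_trans _ _ (3 * M ^+ 4 * s ^+ 2
   + 6 * (c n ^+ 2 * (M ^+ 2 * s * M ^+ 2)) + c n ^+ 4 * M ^+ 4)).
  rewrite -(mulrA 6); apply: lerD h4; apply: lerD => //.
  by rewrite ler_pM2l//; exact: ltr0n.
have -> : 3 * M ^+ 4 * (s + c n ^+ 2) ^+ 2 = 3 * M ^+ 4 * s ^+ 2
   + 6 * (c n ^+ 2 * (M ^+ 2 * s * M ^+ 2)) + 3 * (c n ^+ 4 * M ^+ 4) by ring.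
by lra.
Qed.

End fourth_moment.

(** * Truncation *)

Section truncation.
Context d (T : measurableType d) (R : realType) (P : probability T R).
Implicit Types (X Y : T -> R) (A : set T) (N : R).

Local Notation "''E' X" := (Rintegral P setT X) (at level 10, X at level 8).
Local Notation integr X := (P.-integrable [set: T] (EFin \o X)).

(** A function of the value alone, so applying it to each variable preserves independence. Its
    square depends only on |y|, which is all that equimeasurability controls, and at N = 0 it is the
    identity, so that full second moments are a special case. *)
Definition upper_part N (y : R) : R := y * \1_[set z : R | N < `|z|] y.

Lemma measurable_upper_part N : measurable_fun [set: R] (upper_part N).
Proof.
apply: measurable_funM => //; apply: measurable_indic.
rewrite (_ : [set _ | _] = (@Num.norm _ R) @^-1` `]N, +oo[%classic); last first.
  by apply/seteqP; split => y /=; rewrite in_itv/= andbT.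
rewrite -[X in measurable X]setTI; exact: normr_measurable.
Qed.

Lemma upper_partE N y : upper_part N y = if N < `|y| then y else 0.
Proof.
rewrite /upper_part indicE; case: ifPn => h.
  by rewrite mem_set// mulr1.
by rewrite memNset ?mulr0//=; exact/negP.
Qed.

Lemma lower_part_le N y : 0 <= N -> `|y - upper_part N y| <= N.
Proof.
move=> N0; rewrite upper_partE; case: ltP => [|h].
  by rewrite subrr normr0.
by rewrite subr0.
Qed.

Lemma upper_part_sqr_le N y : upper_part N y ^+ 2 <= y ^+ 2.
Proof. by rewrite upper_partE; case: ifP; rewrite // expr0n sqr_ge0. Qed.

(** Brings the tails of the truncated square to the form {|y| > tau} compared by
    equimeasurability. *)
Lemma upper_part_sqr_gt N y r : 0 <= N -> 0 < r ->
  (r < upper_part N y ^+ 2) = (Num.max N (Num.sqrt r) < `|y|).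
Proof.
move=> N0 r0; rewrite gt_max upper_partE; case: ifPn => _ /=.
  rewrite -sqrtr_sqr; have [->|y0] := eqVneq y 0.
    by rewrite expr0n/= sqrtr0 !ltNge sqrtr_ge0 ltW.
  by rewrite ltr_sqrt// exprn_even_gt0.
by rewrite expr0n/= ltNge (ltW r0).
Qed.

Lemma measurable_upper_part_sqr N X : measurable_fun [set: T] X ->
  measurable_fun [set: T] (fun t => upper_part N (X t) ^+ 2).
Proof.
move=> mX; apply: measurable_funX.
exact: (measurableT_comp (measurable_upper_part N) mX).
Qed.

Lemma Lfun2_upper_part N X : X \in Lfun P 2%:E ->
  (fun t => upper_part N (X t)) \in Lfun P 2%:E.
Proof.
move=> l2X; have mX := Lfun2_measurable l2X.
apply: Lfun2_intro.
  exact: (measurableT_comp (measurable_upper_part N) mX).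
apply: le_integrable (Lfun2_integrable_sqr l2X) => //.
  by apply/measurable_EFinP; exact: measurable_upper_part_sqr.
move=> t _; rewrite /= lee_fin !ger0_norm ?sqr_ge0//.
exact: upper_part_sqr_le.
Qed.

(** Layer-cake formula: the integral of a nonnegative variable is the integral of its tail
    probabilities, and here these are tails of |X| and |Y|. The equality is one of extended reals,
    so it can also transfer finiteness. *)
Lemma equimeasurable_integral_upper_part N X Y :
  measurable_fun [set: T] X -> measurable_fun [set: T] Y ->
  equimeasurable P X Y -> 0 <= N ->
  (\int[P]_t (upper_part N (X t) ^+ 2)%:E =
   \int[P]_t (upper_part N (Y t) ^+ 2)%:E)%E.
Proof.
move=> mX mY XY N0.
have tail Z (mZ : measurable_fun [set: T] Z) :
    (\int[P]_t (upper_part N (Z t) ^+ 2)%:E =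
     \int[lebesgue_measure]_(r in `]0%R, +oo[)
        P [set t | Num.max N (Num.sqrt r) < `|Z t| ]%R)%E.
  pose V t := upper_part N (Z t) ^+ 2.
  have mV : measurable_fun [set: T] V by exact: measurable_upper_part_sqr.
  pose V' : {RV P >-> R} := HB.pack V (isMeasurableFun.Build _ _ _ _ V mV).
  have := @ge0_expectation_ccdf _ T R P V' (fun t => sqr_ge0 _).
  (* The endpoint r = 0 is discarded, because tails are compared only at positive levels. *)
  rewrite unlock => ->; rewrite -integral_itv_obnd_cbnd//; last first.
    by apply: measurable_funTS; exact: ccdf_measurable.
  apply: eq_integral => r; rewrite inE/= in_itv/= andbT => r0.
  rewrite /ccdf /distribution /pushforward; congr (P _).
  by apply/seteqP; split => t /=; rewrite in_itv/= andbT upper_part_sqr_gt.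
rewrite !tail//; apply: eq_integral => r; rewrite inE/= in_itv/= andbT => r0.
by apply: XY; rewrite lt_max sqrtr_gt0 r0 orbT.
Qed.

Lemma upper_part0 y : upper_part 0 y = y.
Proof. by rewrite upper_partE normr_gt0; case: eqVneq. Qed.

(** Truncation level 0 compares the full second moments, one of which is finite. *)
Lemma equimeasurable_Lfun2 X Y : measurable_fun [set: T] X ->
  Y \in Lfun P 2%:E -> equimeasurable P X Y -> X \in Lfun P 2%:E.
Proof.
move=> mX l2Y XY; have mY := Lfun2_measurable l2Y.
have := equimeasurable_integral_upper_part mX mY XY (lexx 0).
under eq_integral do rewrite upper_part0.
under [X in _ = X]eq_integral do rewrite upper_part0.
move=> e; apply: Lfun2_intro => //; apply/integrableP; split.
  by apply/measurable_EFinP; exact: measurable_funX.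
under eq_integral do rewrite /= ger0_norm ?sqr_ge0//.
rewrite e; have /integrableP[_] := Lfun2_integrable_sqr l2Y.
by under [X in (X < _)%E -> _]eq_integral do rewrite /= ger0_norm ?sqr_ge0//.
Qed.

(** Dominated convergence with majorant X^2: at each point the truncated value is 0 as soon as n >=
    |X t|. *)
Lemma upper_part_sqr_small X (eta : R) : X \in Lfun P 2%:E -> 0 < eta ->
  exists2 N, 0 <= N & 'E (fun t => upper_part N (X t) ^+ 2) < eta.
Proof.
move=> l2X eta0; have mX := Lfun2_measurable l2X.
have cvgE : (fun n => \int[P]_t (upper_part n%:R (X t) ^+ 2)%:E)%E @ \oo -->
    (\int[P]_t (cst 0 t))%E.
  have [] := @dominated_convergence _ _ _ P setT measurableT
    (fun n t => (upper_part n%:R (X t) ^+ 2)%:E) (cst 0%E)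
    (fun t => (X t ^+ 2)%:E) => //.
  - by move=> n; apply/measurable_EFinP; exact: measurable_upper_part_sqr.
  - apply: aeW => t _; apply: cvg_near_cst; near=> n.
    rewrite upper_partE ltNge ifF ?expr0n//; apply/negbTE; rewrite negbK.
    by near: n; exact: nbhs_infty_ger.
  - exact: Lfun2_integrable_sqr.
  - apply: aeW => t n _; rewrite /= lee_fin ger0_norm ?sqr_ge0//.
    exact: upper_part_sqr_le.
rewrite integral0 in cvgE.
have /fine_cvg/cvgrPdist_lt h := cvgE.
have [n _ /(_ n (leqnn _))] := h _ eta0.
rewrite /= sub0r normrN => hn; exists n%:R => //.
by apply: le_lt_trans hn; exact: ler_norm.
Unshelve. all: by end_near. Qed.

Lemma E_centered_sqr_le X : X \in Lfun P 2%:E ->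
  'E (fun t => (X t - 'E X) ^+ 2) <= 'E (fun t => X t ^+ 2).
Proof.
move=> l2X; set m := 'E X.
have -> : 'E (fun t => (X t - m) ^+ 2) =
    'E (fun t => X t ^+ 2 + (-2 * m) * X t + m ^+ 2).
  by apply: eq_E => t; ring.
have iX := Lfun2_integrable l2X; have iX2 := Lfun2_integrable_sqr l2X.
rewrite RintegralD//; last 2 first.
- by apply: integrableD_EFin => //; exact: integrableZl_EFin.
- exact: integrable_cst.
rewrite RintegralD//; last exact: integrableZl_EFin.
rewrite RintegralZl// -/m E_cst; have := sqr_ge0 m; lra.
Qed.

(** Splitting the sum as H + L, its square is at most 2 H^2 + 2 L^2. The H term is small on the
    whole space, so its indicator is dropped; on A the L term is traded for lam L^4 + 1 / lam, whose
    constant part contributes only P(A) / lam. The parameter lam stays free to balance the two. *)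
Lemma E_sqr_lincomb_indic_le n (c : nat -> R) (g : nat -> T -> R) A
    (eta N lam : R) :
  (forall k, g k \in Lfun P 2%:E) -> (forall k, 'E (g k) = 0) ->
  independent P g -> measurable A -> 0 <= N -> 0 < lam ->
  (forall k, 'E (fun t => upper_part N (g k t) ^+ 2) <= eta) ->
  'E (fun t => (\sum_(k < n) c k * g k t) ^+ 2 * \1_A t) <=
  2 * (eta * \sum_(k < n) c k ^+ 2)
  + (lam * (3 * (2 * N) ^+ 4 * (\sum_(k < n) c k ^+ 2) ^+ 2)
     + lam^-1 * fine (P A)).
Proof.
move=> l2g Eg Ig mA N0 lam0 geta.
pose m k := 'E (fun t => upper_part N (g k t)).
pose h k t := upper_part N (g k t) - m k.
pose l k t := g k t - upper_part N (g k t) + m k.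
have l2u k := Lfun2_upper_part N (l2g k).
have iu k := Lfun2_integrable (l2u k).
have ig k := Lfun2_integrable (l2g k).
have mg k := Lfun2_measurable (l2g k).
have l2h k : h k \in Lfun P 2%:E.
  by apply: Lfun2B => //; apply: Lfun2_bounded; exact: bounded_mfun_cst.
have mphi k : measurable_fun [set: R] (fun y => upper_part N y - m k).
  by apply: measurable_funB => //; exact: measurable_upper_part.
have mpsi k : measurable_fun [set: R] (fun y => y - upper_part N y + m k).
  apply: measurable_funD => //; apply: measurable_funB => //.
  exact: measurable_upper_part.
have Eh k : 'E (h k) = 0.
  by rewrite RintegralB// ?E_cst ?subrr//; exact: integrable_cst.
have igu k : integr (fun t => g k t - upper_part N (g k t)).
  by apply: Lfun2_integrable; exact: Lfun2B.
have El k : 'E (l k) = 0.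
  rewrite RintegralD ?E_cst//; last exact: integrable_cst.
  by rewrite RintegralB// Eg /m; ring.
have Ih : independent P h by exact: (independent_comp mphi Ig).
have Il : independent P l by exact: (independent_comp mpsi Ig).
have ml k : measurable_fun [set: T] (l k).
  exact: (measurableT_comp (mpsi k) (mg k)).
(* As [g k] is centered, the mean of its upper part is minus that of its lower part, which is
   bounded by N. *)
have mN k : `|m k| <= N.
  have -> : m k = - 'E (fun t => g k t - upper_part N (g k t)).
    by rewrite RintegralB// Eg /m; ring.
  rewrite normrN (le_trans (le_normr_Rintegral _ _))//.
  rewrite -[leRHS](E_cst P N); apply: le_Rintegral => //.
  - exact: integrable_norm.
  - exact: integrable_cst.
  - by move=> t _; exact: lower_part_le.
have lN k t : `|l k t| <= 2 * N.
  rewrite (le_trans (ler_normD _ _))// mulr_natl mulr2n lerD//.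
  exact: lower_part_le.
have bl k : bounded_mfun (l k) by split => //; exists (2 * N).
set s := \sum_(k < n) c k ^+ 2.
pose H t := \sum_(k < n) c k * h k t; pose L t := \sum_(k < n) c k * l k t.
have l2H : H \in Lfun P 2%:E by exact: Lfun2_sum.
have bL : bounded_mfun L.
  have [] := indep_of_tail_lincombX ml Il bl c n 1.
  by under eq_fun do rewrite expr1.
have EH : 'E (fun t => H t ^+ 2) <= eta * s.
  rewrite E_sqr_lincomb// mulr_sumr; apply: ler_sum => k _.
  rewrite mulrC ler_wpM2r ?sqr_ge0// (le_trans _ (geta k))//.
  exact: E_centered_sqr_le.
have EL : 'E (fun t => L t ^+ 4) <= 3 * (2 * N) ^+ 4 * s ^+ 2.
  exact: E_pow4_lincomb_le.
have SHL t : \sum_(k < n) c k * g k t = H t + L t.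
  rewrite -big_split/=; apply: eq_bigr => k _.
  by rewrite /h /l; ring.
have bA : bounded_mfun (\1_A : T -> R) by exact: bounded_mfun_indic.
have iH := Lfun2_integrable_sqr l2H.
have iL := bounded_mfun_integrable P (bounded_mfunX 4 bL).
have iA := bounded_mfun_integrable P bA.
apply: (@le_trans _ _ ('E (fun t => 2 * H t ^+ 2 +
    (lam * L t ^+ 4 + lam^-1 * \1_A t)))).
  apply: le_Rintegral => //.
  - apply: integrable_bounded_mul => //; apply: Lfun2_integrable_sqr.
    exact: Lfun2_sum.
  - apply: integrableD_EFin; first exact: integrableZl_EFin.
    by apply: integrableD_EFin; exact: integrableZl_EFin.
  - move=> t _; rewrite SHL indicE.
    have lamV : lam * lam^-1 = 1 by rewrite mulfV// gt_eqF.
    have H2 := sqr_ge0 (H t); have L4 : 0 <= L t ^+ 4.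
      by rewrite (_ : 4%N = (2 * 2)%N)// exprM sqr_ge0.
    case: (t \in A); rewrite /= ?mulr1 ?mulr0.
      (* AM-GM: [2 L^2 <= lam L^4 + 1 / lam] *)
      have amgm : 2 * L t ^+ 2 <= lam * L t ^+ 4 + lam^-1.
        rewrite -subr_ge0; have -> : lam * L t ^+ 4 + lam^-1 - 2 * L t ^+ 2 =
            lam * (L t ^+ 2 - lam^-1) ^+ 2.
          by field; rewrite gt_eqF.
        by rewrite mulr_ge0 ?sqr_ge0// ltW.
      have := sqr_ge0 (H t - L t); lra.
    by rewrite addr0 addr_ge0// mulr_ge0// ltW.
rewrite RintegralD//; last 2 first.
- exact: integrableZl_EFin.
- by apply: integrableD_EFin; exact: integrableZl_EFin.
rewrite [X in _ + X]RintegralD//; last 2 first.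
- exact: integrableZl_EFin.
- exact: integrableZl_EFin.
rewrite !RintegralZl// E_indic//.
by rewrite lerD// ?ler_pM2l// lerD2r ler_pM2l.
Qed.

End truncation.

(** * Equicontinuity of norms *)

Section equicontinuity.
Context d (T : measurableType d) (R : realType) (P : probability T R).
Implicit Types (X Y : T -> R) (A : set T).

Local Notation "''E' X" := (Rintegral P setT X) (at level 10, X at level 8).

Lemma L2norm_lt_E_sqr X (e : R) : X \in Lfun P 2%:E -> 0 < e ->
  (L2norm P X < e%:E)%E -> 'E (fun t => X t ^+ 2) < e ^+ 2.
Proof.
move=> l2X e0; rewrite L2norm_sqrt// lte_fin => h.
have E0 : 0 <= 'E (fun t => X t ^+ 2).
  by apply: Rintegral_ge0 => t _; exact: sqr_ge0.
by rewrite -(sqr_sqrtr E0) ltr_pXn2r// nnegrE ?sqrtr_ge0// ltW.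
Qed.

Lemma L2norm_le_E_sqr X (e : R) : X \in Lfun P 2%:E -> 0 <= e ->
  (L2norm P X <= e%:E)%E = ('E (fun t => X t ^+ 2) <= e ^+ 2).
Proof.
move=> l2X e0; rewrite L2norm_sqrt// lee_fin.
have E0 : 0 <= 'E (fun t => X t ^+ 2).
  by apply: Rintegral_ge0 => t _; exact: sqr_ge0.
by rewrite -[in RHS](sqr_sqrtr E0) ler_pXn2r// nnegrE ?sqrtr_ge0.
Qed.

Lemma E_indic_sqr_le X A : X \in Lfun P 2%:E -> measurable A ->
  'E (fun t => X t ^+ 2 * \1_A t) <= 'E (fun t => X t ^+ 2).
Proof.
move=> l2X mA; have iX := Lfun2_integrable_sqr l2X.
apply: le_Rintegral => //.
  by apply: integrable_bounded_mul => //; exact: bounded_mfun_indic.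
move=> t _; rewrite indicE; case: (t \in A); rewrite /= ?mulr1// mulr0.
exact: sqr_ge0.
Qed.

Lemma sqr_indic X A t : (X t * \1_A t) ^+ 2 = X t ^+ 2 * \1_A t.
Proof.
by rewrite indicE; case: (t \in A); rewrite /= ?mulr1// !mulr0 expr0n.
Qed.

(** X 1_A = (X - Y) 1_A + Y 1_A. This carries smallness on A from linear combinations to their
    limits. *)
Lemma E_sqr_indic_approx X Y A : X \in Lfun P 2%:E -> Y \in Lfun P 2%:E ->
  measurable A ->
  'E (fun t => X t ^+ 2 * \1_A t) <=
  2 * 'E (fun t => (X t - Y t) ^+ 2) + 2 * 'E (fun t => Y t ^+ 2 * \1_A t).
Proof.
move=> l2X l2Y mA.
have bA : bounded_mfun (\1_A : T -> R) by exact: bounded_mfun_indic.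
have l2D := Lfun2B l2X l2Y.
have := E_sqrD_le (Lfun2M_bounded l2D bA) (Lfun2M_bounded l2Y bA).
under eq_Rintegral do rewrite -mulrDl subrK sqr_indic.
under [X in _ <= 2 * X + _]eq_Rintegral do
  rewrite (sqr_indic (fun t => X t - Y t)).
under [X in _ <= _ + 2 * X]eq_Rintegral do rewrite sqr_indic.
move/le_trans; apply; rewrite lerD2r ler_pM2l//.
exact: E_indic_sqr_le.
Qed.

Variables (g : nat -> T -> R) (f : T -> R).
Hypothesis mg : forall k, measurable_fun [set: T] (g k).
Hypothesis Eg : forall k, (\int[P]_t (g k t)%:E)%E = 0%E.
Hypothesis Ig : independent P g.
Hypothesis l2f : f \in Lfun P 2%:E.
Hypothesis gf : forall k, equimeasurable P (g k) f.

Let l2g k : g k \in Lfun P 2%:E.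
Proof. exact: equimeasurable_Lfun2 (gf k). Qed.

Let Eg0 k : 'E (g k) = 0. Proof. by rewrite /Rintegral Eg. Qed.

Let E_upper_part k N : 0 <= N ->
  'E (fun t => upper_part N (g k t) ^+ 2) =
  'E (fun t => upper_part N (f t) ^+ 2).
Proof.
move=> N0; congr fine; apply: equimeasurable_integral_upper_part => //.
exact: (Lfun2_measurable l2f).
Qed.

Let Eg2 k : 'E (fun t => g k t ^+ 2) = 'E (fun t => f t ^+ 2).
Proof.
have := E_upper_part k (lexx 0).
under eq_Rintegral do rewrite upper_part0.
by under [X in _ = X]eq_Rintegral do rewrite upper_part0.
Qed.

Local Notation ball := (unit_ball P (closed_linear_span P g)).

(** The choices are made in the order N, [lam], [delta], each depending only on e, f and the
    previous ones, never on n or c. The bound 4 instead of 1 leaves room for approximants of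
    elements of the unit ball. *)
Lemma lincomb_uniformly_small (e : R) : 0 < e ->
  exists2 delta : R, 0 < delta & forall n (c : nat -> R) A,
    'E (fun t => (\sum_(k < n) c k * g k t) ^+ 2) <= 4 ->
    measurable A -> fine (P A) < delta ->
    'E (fun t => (\sum_(k < n) c k * g k t) ^+ 2 * \1_A t) <= e.
Proof.
move=> e0; set v := 'E (fun t => f t ^+ 2).
have v0 : 0 <= v by apply: Rintegral_ge0 => t _; exact: sqr_ge0.
have ES n (c : nat -> R) : 'E (fun t => (\sum_(k < n) c k * g k t) ^+ 2) =
    (\sum_(k < n) c k ^+ 2) * v.
  by rewrite E_sqr_lincomb// mulr_suml; apply: eq_bigr => k _; rewrite Eg2.
(* If v = 0 all combinations have norm 0 and any [delta] works; otherwise v s <= 4 bounds s by 4 /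
   v. *)
have [v0'|vN0] := eqVneq v 0.
  exists 1 => // n c A _ mA _.
  rewrite (le_trans (E_indic_sqr_le _ mA)) ?ES ?v0' ?mulr0 ?ltW//.
  exact: Lfun2_sum.
have vgt0 : 0 < v by rewrite lt_neqAle eq_sym vN0.
pose s0 := 4 / v.
have s0gt0 : 0 < s0 by rewrite divr_gt0.
(* Each of the three terms of the bound is to be at most e / 4; this level handles the first, [lam]
   the second and [delta] the third. *)
have [|N N0 EN] := @upper_part_sqr_small _ _ _ P f (e / (8 * s0)) l2f.
  by rewrite divr_gt0// mulr_gt0.
(* The summand 1 keeps K positive when N = 0. *)
pose K := 3 * (2 * N) ^+ 4 * s0 ^+ 2 + 1.
have K0 : 0 < K.
  rewrite ltr_pwDr// mulr_ge0// ?sqr_ge0// mulr_ge0// exprn_ge0//.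
  by rewrite mulr_ge0.
pose lam := e / (4 * K).
have lam0 : 0 < lam by rewrite divr_gt0// mulr_gt0.
exists (lam * (e / 4)); first by rewrite mulr_gt0// divr_gt0.
move=> n c A; rewrite ES => sv mA PA.
set s := \sum_(k < n) c k ^+ 2 in sv.
have sge0 : 0 <= s by apply: sumr_ge0 => k _; exact: sqr_ge0.
have ss0 : s <= s0 by rewrite ler_pdivlMr.
rewrite (le_trans (E_sqr_lincomb_indic_le n c (eta := e / (8 * s0))
  l2g Eg0 Ig mA N0 lam0 _))//.
  by move=> k; rewrite E_upper_part// ltW.
rewrite -/s.
have h1 : 2 * (e / (8 * s0) * s) <= e / 4.
  apply: (@le_trans _ _ (2 * (e / (8 * s0) * s0))).
    rewrite ler_pM2l//; apply: ler_wpM2l => //.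
    by apply: ltW; apply: divr_gt0 => //; apply: mulr_gt0.
  by rewrite le_eqVlt; apply/orP; left; apply/eqP; field; rewrite gt_eqF.
have h2 : lam * (3 * (2 * N) ^+ 4 * s ^+ 2) <= e / 4.
  apply: (@le_trans _ _ (lam * K)).
    rewrite ler_pM2l//; apply: ler_wpDr => //; apply: ler_wpM2l.
      by rewrite mulr_ge0// exprn_ge0// mulr_ge0.
    by rewrite lerXn2r ?nnegrE// ltW.
  by rewrite /lam le_eqVlt; apply/orP; left; apply/eqP; field; rewrite gt_eqF.
have h3 : lam^-1 * fine (P A) <= e / 4.
  by rewrite mulrC ler_pdivrMr// mulrC ltW.
lra.
Qed.

Lemma unit_ball_uniformly_small (e : R) : 0 < e ->
  exists2 delta : R, 0 < delta & forall x A, ball x ->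
    measurable A -> fine (P A) < delta ->
    'E (fun t => x t ^+ 2 * \1_A t) <= e.
Proof.
move=> e0.
have [|delta delta0 small] := @lincomb_uniformly_small (e / 4).
  by rewrite divr_gt0.
exists delta => // x A [[l2x clx] x1] mA PA.
(* With r <= 1, an approximant within r of x has squared norm at most 2 + 2 = 4. With r^2 <= r <= e
   / 4, the approximation error contributes at most e / 2, and the approximant the other e / 2. *)
pose r := Num.min 1 (e / 4).
have r0 : 0 < r by rewrite lt_min ltr01 divr_gt0.
have [y [n [c ->{y}]] /L2norm_lt_E_sqr xy] := clx _ r0.
have l2S := Lfun2_sum n c l2g.
have l2D := Lfun2B l2x l2S.
have {}xy := xy l2D r0.
have r1 : r <= 1 by rewrite ge_min lexx.
have re : r <= e / 4 by rewrite ge_min lexx orbT.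
have rr : r ^+ 2 <= r by rewrite expr2 ler_piMr// ltW.
have Ex : 'E (fun t => x t ^+ 2) <= 1.
  by have := x1; rewrite L2norm_le_E_sqr// expr1n.
have ES : 'E (fun t => (\sum_(k < n) c k * g k t) ^+ 2) <= 4.
  have := E_sqrD_le (Lfun2Z (-1) l2D) l2x.
  rewrite (@eq_E _ _ _ P (fun t => (-1 * (x t - _) + x t) ^+ 2)
    (fun t => (\sum_(k < n) c k * g k t) ^+ 2)); last first.
    by move=> t /=; congr (_ ^+ 2); ring.
  rewrite (@eq_E _ _ _ P (fun t => (-1 * (x t - _)) ^+ 2)
    (fun t => (x t - \sum_(k < n) c k * g k t) ^+ 2)); last first.
    by move=> t /=; rewrite mulN1r sqrrN.
  move: xy => /= xy; lra.
have := E_sqr_indic_approx l2x l2S mA.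
have := small n c A ES mA PA.
move: xy => /= xy; lra.
Qed.

Let ball0 : ball (fun=> 0).
Proof.
have l20 : (fun=> 0 : R) \in Lfun P 2%:E.
  by apply: Lfun2_bounded; exact: bounded_mfun_cst.
have n0 : L2norm P (fun=> 0 : R) = 0%E by exact: Lnorm0.
split; last by rewrite n0.
split => // e e0; exists (fun=> 0); last first.
  rewrite (_ : _ \- _ = fun=> 0) ?n0//.
  by apply/funext => t /=; rewrite subrr.
by exists 0, (fun=> 0); apply/funext => t; rewrite big_ord0.
Qed.

Lemma equicontinuous_norms_unit_ball : equicontinuous_norms P ball.
Proof.
rewrite /equicontinuous_norms; set F := fun delta : R => ereal_sup _.
(* Both suprema range over nonempty sets, thanks to [set0] and the zero function. For delta <= 0 no
   set qualifies and the supremum is -oo. *)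
have F_ge0 delta : 0 < delta -> (0 <= F delta)%E.
  move=> delta0.
  apply: (@le_trans _ _ (ereal_sup [set L2norm P (x \* \1_set0) | x in ball])).
    apply: ereal_sup_ubound; exists (fun=> 0) => //.
    rewrite -[RHS](@Lnorm0 _ _ _ P 2%:E)//; congr (Lnorm _ _ _).
    by apply/funext => t /=; rewrite mul0r.
  apply: ereal_sup_ubound; exists set0 => //.
  by split => //; rewrite measure0 lte_fin.
have F_le e : 0 < e -> \forall delta \near 0^'+, (F delta <= e%:E)%E.
  move=> e0.
  (* The estimate concerns squared norms, hence [e ^+ 2]. *)
  have [|delta0 delta0_gt0 small] := @unit_ball_uniformly_small (e ^+ 2).
    by rewrite exprn_gt0.
  near=> delta.
  apply: ge_ereal_sup => _ [A [mA PA] <-].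
  apply: ge_ereal_sup => _ [x xball <-].
  have l2x : x \in Lfun P 2%:E by case: xball => -[].
  have bA : bounded_mfun (\1_A : T -> R) by exact: bounded_mfun_indic.
  rewrite L2norm_le_E_sqr; [|exact: Lfun2M_bounded|exact: ltW].
  under eq_Rintegral do rewrite /= sqr_indic.
  apply: small => //.
  apply: (@lt_trans _ _ delta).
    by rewrite -lte_fin fineK// fin_num_measure.
  by near: delta; exact: nbhs_right_lt.
(* Extended-real convergence splits into eventual finiteness, from [F_le] at 1, and convergence of
   the real values. *)
apply/fine_cvgP; split.
  near=> delta; rewrite ge0_fin_numE; last first.
    by apply: F_ge0; near: delta; exact: nbhs_right_gt.
  apply: (@le_lt_trans _ _ 1%:E); last by rewrite ltry.
  by near: delta; exact: F_le.
apply/cvgrPdist_le => e e0; near=> delta.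
have F0 : (0 <= F delta)%E.
  by apply: F_ge0; near: delta; exact: nbhs_right_gt.
have Fe : (F delta <= e%:E)%E by near: delta; exact: F_le.
rewrite /= sub0r normrN ger0_norm ?fine_ge0// -lee_fin fineK//.
by rewrite ge0_fin_numE// (le_lt_trans Fe) ?ltry.
Unshelve. all: by end_near. Qed.

End equicontinuity.

(** The case of the probability measure [lebesgue01 R] in the result for arbitrary probability
    spaces. *)
Theorem theorem4 (R : realType) (f_ : nat -> lebesgue_line R -> R)
    (f : lebesgue_line R -> R) :
  (forall k, measurable_fun [set: lebesgue_line R] (f_ k)) ->
  (forall k, (\int[lebesgue01 R]_t (f_ k t)%:E)%E = 0%E) ->
  independent (lebesgue01 R) f_ ->
  f \in Lfun (lebesgue01 R) 2%:E ->
  (forall k, equimeasurable (lebesgue01 R) (f_ k) f) ->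
  equicontinuous_norms (lebesgue01 R)
    (unit_ball (lebesgue01 R) (closed_linear_span (lebesgue01 R) f_)).
Proof.
move=> mf Ef If l2f ff; exact: equicontinuous_norms_unit_ball l2f ff.
Qed.
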